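(* Let $k$ be a field with $u(k)\leq 2$ which is not quadratically closed, with $\mathrm{char}(k)\neq 2$ and $|k|\geq 5$. Let $G:=\mathrm{PSL}_2(k)$ and let $\mathscr{C}_1,\mathscr{C}_2$ be two distinct semisimple conjugacy classes in $G$. Then $\mathscr{C}_1\mathscr{C}_2=G\setminus\{1\}$.
   Context: A field $k$ has $u(k)\leq 2$ if every quadratic form in $3$ variables over $k$ is isotropic. A field is quadratically closed if it admits no quadratic extension. ''Semisimple class'' means a non-central semisimple conjugacy class; in $\mathrm{PSL}_2(k)=\mathrm{SL}_2(k)/\{\pm I\}$, a semisimple element is the image of a non-central semisimple element of $\mathrm{SL}_2(k)$. $\mathscr{C}_1\mathscr{C}_2=\{xy: x\in\mathscr{C}_1,y\in\mathscr{C}_2\}$. *)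

(* Defs.v *)
From HB Require Import structures.
From mathcomp Require Import all_boot all_order all_algebra all_field.
From mathcomp Require Import boolp classical_sets.

Set Implicit Arguments.
Unset Strict Implicit.
Unset Printing Implicit Defensive.

Import GRing.Theory.
Local Open Scope ring_scope.
Local Open Scope quotient_scope.
Local Open Scope classical_set_scope.

(* The quadratic form \sum_(i, j) A i j x_i x_j. The matrix A is not assumed
   symmetric, so that every homogeneous polynomial of degree 2 arises this way
   in any characteristic. *)
Definition qform (k : fieldType) (n : nat) (A : 'M[k]_n) (v : 'rV[k]_n) : k :=
  (v *m A *m v^T) 0 0.

Definition isotropic (k : fieldType) (n : nat) (A : 'M[k]_n) : Prop :=
  exists v : 'rV[k]_n, v != 0 /\ qform A v = 0.

Definition u_invariant_le2 (k : fieldType) : Prop :=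
  forall A : 'M[k]_3, isotropic A.

Definition quadratically_closed (k : fieldType) : Prop :=
  ~ exists L : fieldExtType k, \dim {:L} = 2%N.

Definition card_ge (T : eqType) (n : nat) : Prop :=
  exists s : seq T, uniq s /\ (n <= size s)%N.

Section SL2.
Variable k : fieldType.

Record SL2 := MkSL2 { SL2val :> 'M[k]_2; SL2_det : \det SL2val == 1 }.

HB.instance Definition _ := [isSub for SL2val].
HB.instance Definition _ := [Choice of SL2 by <:].

Implicit Types A B C : SL2.

Lemma det_SL2 A : \det (SL2val A) = 1.
Proof. exact/eqP/SL2_det. Qed.

Lemma SL2_unitmx A : SL2val A \in unitmx.
Proof. by rewrite unitmxE det_SL2 unitr1. Qed.

Fact SL2_one_subproof : \det (1%:M : 'M[k]_2) == 1.
Proof. by rewrite det1. Qed.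
Definition SL2_one := MkSL2 SL2_one_subproof.

Fact SL2_mul_subproof A B : \det (SL2val A *m SL2val B) == 1.
Proof. by rewrite det_mulmx !det_SL2 mulr1. Qed.
Definition SL2_mul A B := MkSL2 (SL2_mul_subproof A B).

Fact SL2_inv_subproof A : \det (invmx (SL2val A)) == 1.
Proof. by rewrite det_inv det_SL2 invr1. Qed.
Definition SL2_inv A := MkSL2 (SL2_inv_subproof A).

Fact SL2_opp_subproof A : \det (- SL2val A) == 1.
Proof. by rewrite -scaleN1r detZ det_SL2 sqrrN expr1n mulr1. Qed.
Definition SL2_opp A := MkSL2 (SL2_opp_subproof A).

Fact SL2_mulA : associative SL2_mul.
Proof. by move=> A B C; apply: val_inj; rewrite /= mulmxA. Qed.

Fact SL2_mul1 : left_id SL2_one SL2_mul.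
Proof. by move=> A; apply: val_inj; rewrite /= mul1mx. Qed.

Fact SL2_mulr1 : right_id SL2_one SL2_mul.
Proof. by move=> A; apply: val_inj; rewrite /= mulmx1. Qed.

Fact SL2_mulV : left_inverse SL2_one SL2_inv SL2_mul.
Proof. by move=> A; apply: val_inj; rewrite /= mulVmx ?SL2_unitmx. Qed.

Fact SL2_mulrV : right_inverse SL2_one SL2_inv SL2_mul.
Proof. by move=> A; apply: val_inj; rewrite /= mulmxV ?SL2_unitmx. Qed.

HB.instance Definition _ :=
  isGroup.Build SL2 SL2_mulA SL2_mul1 SL2_mulr1 SL2_mulV SL2_mulrV.

Lemma SL2_mulE A B : (A * B)%g = SL2_mul A B. Proof. by []. Qed.
Lemma SL2_invE A : (A^-1)%g = SL2_inv A. Proof. by []. Qed.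
Lemma SL2_oneE : 1%g = SL2_one. Proof. by []. Qed.

(* A and B lie in the same coset of {1, -1}. *)
Definition SL2_sim : rel SL2 := fun A B => (A == B) || (A == SL2_opp B).

Lemma SL2_oppK : involutive SL2_opp.
Proof. by move=> A; apply: val_inj; rewrite /= opprK. Qed.

Fact SL2_sim_refl : reflexive SL2_sim.
Proof. by move=> A; rewrite /SL2_sim eqxx. Qed.

Fact SL2_sim_sym : symmetric SL2_sim.
Proof.
move=> A B; rewrite /SL2_sim eq_sym; congr (_ || _).
by rewrite -(inv_eq SL2_oppK) eq_sym.
Qed.

Fact SL2_sim_trans : transitive SL2_sim.
Proof.
move=> B A C /orP[] /eqP-> /orP[] /eqP->; rewrite /SL2_sim ?SL2_oppK eqxx //.
all: by rewrite ?orbT.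
Qed.

Canonical SL2_sim_equiv := EquivRel SL2_sim SL2_sim_refl SL2_sim_sym SL2_sim_trans.

Definition PSL2 := {eq_quot SL2_sim}.

HB.instance Definition _ : EqQuotient _ SL2_sim PSL2 := EqQuotient.on PSL2.
HB.instance Definition _ := Choice.on PSL2.

Definition toPSL2 (A : SL2) : PSL2 := \pi_PSL2 A.

Lemma toPSL2_eq A B : (toPSL2 A == toPSL2 B) = SL2_sim A B.
Proof. exact: (@pi_eq_quot _ SL2_sim PSL2). Qed.

Lemma PSL2_reprK (x : PSL2) : toPSL2 (repr x) = x.
Proof. exact: reprK. Qed.

Definition PSL2_one : PSL2 := toPSL2 1%g.
Definition PSL2_mul (x y : PSL2) : PSL2 := toPSL2 (repr x * repr y)%g.
Definition PSL2_inv (x : PSL2) : PSL2 := toPSL2 (repr x)^-1%g.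

Lemma repr_toPSL2 A :
  repr (toPSL2 A) = A \/ repr (toPSL2 A) = SL2_opp A.
Proof.
have /eqP := PSL2_reprK (toPSL2 A).
by rewrite toPSL2_eq => /orP[] /eqP; [left | right].
Qed.

Lemma toPSL2_opp A : toPSL2 (SL2_opp A) = toPSL2 A.
Proof. by apply/eqP; rewrite toPSL2_eq /SL2_sim eqxx orbT. Qed.

Lemma SL2_mulNl A B : SL2_mul (SL2_opp A) B = SL2_opp (SL2_mul A B).
Proof. by apply: val_inj; rewrite /= mulNmx. Qed.

Lemma SL2_mulNr A B : SL2_mul A (SL2_opp B) = SL2_opp (SL2_mul A B).
Proof. by apply: val_inj; rewrite /= mulmxN. Qed.

Lemma toPSL2_mul A B : PSL2_mul (toPSL2 A) (toPSL2 B) = toPSL2 (A * B)%g.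
Proof.
rewrite /PSL2_mul !SL2_mulE.
by case: (repr_toPSL2 A) => ->; case: (repr_toPSL2 B) => ->;
   rewrite ?SL2_mulNl ?SL2_mulNr ?SL2_oppK ?toPSL2_opp.
Qed.

Fact PSL2_mulA : associative PSL2_mul.
Proof.
move=> x y z; rewrite -(PSL2_reprK x) -(PSL2_reprK y) -(PSL2_reprK z).
by rewrite !toPSL2_mul !SL2_mulE SL2_mulA.
Qed.

Fact PSL2_mul1 : left_id PSL2_one PSL2_mul.
Proof.
by move=> x; rewrite -(PSL2_reprK x) toPSL2_mul SL2_mulE SL2_mul1.
Qed.

Fact PSL2_mulr1 : right_id PSL2_one PSL2_mul.
Proof.
by move=> x; rewrite -(PSL2_reprK x) toPSL2_mul SL2_mulE SL2_mulr1.
Qed.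

Fact PSL2_mulV : left_inverse PSL2_one PSL2_inv PSL2_mul.
Proof.
move=> x; rewrite -[X in PSL2_mul _ X]PSL2_reprK toPSL2_mul.
by rewrite SL2_mulE SL2_mulV.
Qed.

Fact PSL2_mulrV : right_inverse PSL2_one PSL2_inv PSL2_mul.
Proof.
move=> x; rewrite -[X in PSL2_mul X _]PSL2_reprK toPSL2_mul.
by rewrite SL2_mulE SL2_mulrV.
Qed.

HB.instance Definition _ :=
  isGroup.Build PSL2 PSL2_mulA PSL2_mul1 PSL2_mulr1 PSL2_mulV PSL2_mulrV.

Lemma toPSL2M A B : toPSL2 (A * B)%g = (toPSL2 A * toPSL2 B)%g.
Proof. by rewrite -toPSL2_mul. Qed.

Lemma toPSL2_1 : toPSL2 1%g = 1%g. Proof. by []. Qed.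

Definition central_SL2 (A : SL2) : Prop := forall B : SL2, commute A B.

(* Diagonalizable over an algebraic closure of k: the entries of a
   diagonalizing matrix generate a finite extension L of k. *)
Definition semisimple_SL2 (A : SL2) : Prop :=
  exists L : fieldExtType k, diagonalizable (map_mx (in_alg L) (SL2val A)).

Definition semisimple_PSL2 (g : PSL2) : Prop :=
  exists A : SL2, [/\ semisimple_SL2 A, ~ central_SL2 A & toPSL2 A = g].

End SL2.

Definition conj_class (G : groupType) (g : G) : set G :=
  [set (g ^ x)%g | x in [set: G]].

Definition set_prod (G : groupType) (C1 C2 : set G) : set G :=
  [set (x * y)%g | x in C1 & y in C2].

Definition semisimple_class (k : fieldType) (C : set (PSL2 k)) : Prop :=
  exists g : PSL2 k, semisimple_PSL2 g /\ C = conj_class g.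

(* Main.v *)
(* Since binary forms over a field with [u <= 2] are universal, an element of
   SL2 with trace t, t^2 <> 4, is SL2-conjugate to the companion matrix of t, so
   a semisimple class of PSL2 is determined by its trace up to sign. It remains
   to factor a non-scalar g of trace t as XY with tr X = t1 and tr Y = t2; we may
   take g to be a companion matrix. The trace conditions cut out an affine plane
   of matrices X, in which det X = 1 is a conic; its homogenization has a point,
   and if that point is at infinity then t1 <> t2, - t2 provides an affine one. *)
Require Import Defs.
From mathcomp Require Import all_boot all_order all_algebra all_field.
From mathcomp Require Import boolp classical_sets.
From mathcomp Require Import ring.

Set Implicit Arguments.
Unset Strict Implicit.
Unset Printing Implicit Defensive.

Import GRing.Theory.
Local Open Scope ring_scope.

Lemma ord2P (i : 'I_2) : i = 0 \/ i = 1.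
Proof. by case: i => [[|[|]]] //= ?; [left | right]; apply: val_inj. Qed.

(** * Entries, trace and determinant of 2 x 2 matrices *)

Section Matrix22.
Variable R : comNzRingType.
Implicit Types A B : 'M[R]_2.

Lemma eq_mx22 A B : A 0 0 = B 0 0 -> A 0 1 = B 0 1 -> A 1 0 = B 1 0 ->
  A 1 1 = B 1 1 -> A = B.
Proof.
by move=> ????; apply/matrixP=> i j; case: (ord2P i) (ord2P j) => -> [] ->.
Qed.

Lemma mulmx22E A B i j : (A *m B) i j = A i 0 * B 0 j + A i 1 * B 1 j.
Proof.
rewrite mxE !big_ord_recl big_ord0 addr0.
by have -> : lift ord0 ord0 = 1 :> 'I_2 by apply: val_inj.
Qed.

Lemma mxtrace22 A : \tr A = A 0 0 + A 1 1.
Proof.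
rewrite /mxtrace !big_ord_recl big_ord0 addr0.
by have -> : lift ord0 ord0 = 1 :> 'I_2 by apply: val_inj.
Qed.

Lemma det_mx22 A : \det A = A 0 0 * A 1 1 - A 0 1 * A 1 0.
Proof.
rewrite (expand_det_row _ 0) !big_ord_recl big_ord0 addr0 /cofactor.
rewrite !det_mx11 !mxE /= expr0 expr1 mul1r mulN1r mulrN.
have -> : lift ord0 ord0 = 1 :> 'I_2 by apply: val_inj.
by have -> : lift 1 0 = 0 :> 'I_2 by apply: val_inj.
Qed.

Definition mx22 (a b c d : R) : 'M[R]_2 :=
  \matrix_(i, j) if i == 0 then if j == 0 then a else b
                 else if j == 0 then c else d.

Lemma mx22E a b c d :
  (mx22 a b c d 0 0 = a) * (mx22 a b c d 0 1 = b) *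
  (mx22 a b c d 1 0 = c) * (mx22 a b c d 1 1 = d).
Proof. by rewrite !mxE. Qed.

End Matrix22.

(** * Consequences of ternary isotropy for binary forms and conics *)

Section Forms.
Variable k : fieldType.
Hypothesis hu : u_invariant_le2 k.

Lemma ternary_isotropic (a b c d e f : k) :
  exists x y z, [|| x != 0, y != 0 | z != 0] /\
    a * x ^+ 2 + b * y ^+ 2 + c * z ^+ 2
      + d * (x * y) + e * (x * z) + f * (y * z) = 0.
Proof.
(* Upper triangular rather than symmetric, so that no cross coefficient is halved. *)
pose M : 'M[k]_3 := \matrix_(i, j)
  nth 0 (nth [::] [:: [:: a; d; e]; [:: 0; b; f]; [:: 0; 0; c]] i) j.
have [v [v0 qv]] := hu M; pose i1 : 'I_3 := lift ord0 ord0.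
pose i2 : 'I_3 := lift ord0 (lift ord0 ord0).
exists (v 0 ord0), (v 0 i1), (v 0 i2); split.
  apply: contraNT v0; rewrite !negb_or !negbK => /and3P[/eqP x0 /eqP y0 /eqP z0].
  apply/eqP/rowP=> i; rewrite mxE; case: i => [[|[|[|]]]] //= h.
  - by rewrite -[RHS]x0; congr (v _ _); apply: val_inj.
  - by rewrite -[RHS]y0; congr (v _ _); apply: val_inj.
  - by rewrite -[RHS]z0; congr (v _ _); apply: val_inj.
rewrite -{}[RHS]qv /qform !mxE !big_ord_recl !big_ord0 !mxE.
rewrite !big_ord_recl !big_ord0 !mxE /= -/i1 -/i2; ring.
Qed.

(* If the isotropic vector of the form minus [z^2] has [z = 0], the form is itself
   isotropic, hence hyperbolic. *)
Lemma binary_represents1 (a b c : k) : b ^+ 2 - 4%:R * a * c != 0 ->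
  exists x y, a * x ^+ 2 + b * (x * y) + c * y ^+ 2 = 1.
Proof.
move=> dn0; have [x [y [z [nz e]]]] := ternary_isotropic a c (- 1) b 0 0.
have [z0|z0] := eqVneq z 0; last first.
  exists (x / z), (y / z); apply: (mulIf (expf_neq0 2 z0)).
  rewrite mul1r -[RHS]addr0 -{}e; field.
  by [].
rewrite {z}z0 eqxx orbF in nz e.
have {}e : a * x ^+ 2 + b * (x * y) + c * y ^+ 2 = 0 by rewrite -e; ring.
(* The partial derivatives of the form at [(x, y)]: [u * p + v * q] is the polar form of [(u, v)]
   and [(x, y)]. When it is 1, adding [s] times the isotropic vector to [(u, v)] raises the value by
   [s]. *)
set p := 2%:R * a * x + b * y; set q := b * x + 2%:R * c * y.
suff [u [v uv]] : exists u v, u * p + v * q = 1.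
  pose s := 1 - (a * u ^+ 2 + b * (u * v) + c * v ^+ 2).
  exists (u + s * x), (v + s * y).
  transitivity (a * u ^+ 2 + b * (u * v) + c * v ^+ 2 + s * (u * p + v * q)
    + s ^+ 2 * (a * x ^+ 2 + b * (x * y) + c * y ^+ 2)).
    by rewrite /p /q; ring.
  by rewrite uv e /s; ring.
have [p0|p0] := eqVneq p 0; last by exists p^-1, 0; field.
have [q0|q0] := eqVneq q 0; last by exists 0, q^-1; field.
(* The adjugate of the Hessian recovers [(x, y)] from [(p, q)], up to the discriminant. *)
have xe : (b ^+ 2 - 4%:R * a * c) * x = 0.
  transitivity (b * q - 2%:R * c * p); first by rewrite /p /q; ring.
  by rewrite p0 q0; ring.
have ye : (b ^+ 2 - 4%:R * a * c) * y = 0.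
  transitivity (b * p - 2%:R * a * q); first by rewrite /p /q; ring.
  by rewrite p0 q0; ring.
move/eqP: xe; move/eqP: ye; rewrite !mulf_eq0 !(negbTE dn0) /= => y0 x0.
by rewrite x0 y0 in nz.
Qed.

(* The entries of [X = [[p, q], [q + t p - t2, t1 - p]]]: with [C] the companion
   matrix of trace [t], [X] has trace [t1] and [X^-1 C] has trace [t2] whatever
   [p] and [q]; the equation below is [det X = 1]. *)
Lemma conic_point (t t1 t2 : k) : t1 <> t2 -> t1 <> - t2 ->
  exists p q, p * (t1 - p) - q * (q + t * p - t2) = 1.
Proof.
move=> n1 n2.
have [p [q [s [nz e]]]] := ternary_isotropic 1 1 1 t (- t1) (- t2).
have [s0|s0] := eqVneq s 0; last first.
  exists (p / s), (q / s); apply: (mulIf (expf_neq0 2 s0)).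
  rewrite mul1r -[RHS]subr0 -{}e; field.
  by [].
rewrite {s}s0 eqxx orbF in nz e.
have q0 : q != 0.
  apply: contraTneq nz => q0; move/eqP: e.
  by rewrite q0 !(mulr0, expr0n, addr0, mul1r) /= expf_eq0 /= eqxx orbF negbK.
pose l := p / q.
have le : l ^+ 2 + t * l + 1 = 0.
  apply: (mulIf (expf_neq0 2 q0)); rewrite mul0r -[RHS]e /l; field.
  by [].
(* On the line [p = l q + w], parallel to an asymptote, the conic is linear. *)
suff [w w0] : exists w, (2%:R * l + t) * w - t1 * l - t2 != 0.
  pose d := (2%:R * l + t) * w - t1 * l - t2.
  pose u := - (w ^+ 2 - t1 * w + 1) / d.
  have du : d * u + (w ^+ 2 - t1 * w + 1) = 0.
    by rewrite /u mulrC divfK ?addNr.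
  exists (l * u + w), u.
  transitivity (1 - u ^+ 2 * (l ^+ 2 + t * l + 1)
    - (d * u + (w ^+ 2 - t1 * w + 1))); first by rewrite /d; ring.
  by rewrite le du; ring.
have [c0|c0] := eqVneq (2%:R * l + t) 0; last first.
  exists ((t1 * l + t2 + 1) / (2%:R * l + t)).
  by rewrite mulrC divfK // (_ : _ - _ = 1) ?oner_eq0 //; ring.
(* Here [l] is a double root of a monic quadratic with constant term 1, so [l] is 1 or -1, and
   [t1 * l + t2 = 0] is excluded by [n1] and [n2]. *)
exists 0; rewrite mulr0 sub0r; apply/eqP=> h.
have : (l - 1) * (l + 1) = 0.
  transitivity (l * (2%:R * l + t) - (l ^+ 2 + t * l + 1)); first by ring.
  by rewrite c0 le; ring.
have {}h : t2 = - (t1 * l) by rewrite -[LHS]addr0 -h; ring.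
move/eqP; rewrite mulf_eq0 subr_eq0 addr_eq0 => /orP[] /eqP l1.
  by apply: n2; rewrite h l1; ring.
by apply: n1; rewrite h l1; ring.
Qed.

End Forms.

(** * Traces, conjugacy and factorization in SL2, then passage to PSL2 *)

Section SL2Theory.
Variable k : fieldType.
Implicit Types A B C P X Y : SL2 k.

Lemma companion_det (t : k) : \det (mx22 0 1 (- 1) t) == 1.
Proof. by apply/eqP; rewrite det_mx22 !mx22E; ring. Qed.
Definition companion t : SL2 k := MkSL2 (companion_det t).

Lemma det_SL2E A : A 0 0 * A 1 1 - A 0 1 * A 1 0 = 1.
Proof. by rewrite -det_mx22 det_SL2. Qed.

Lemma mxtrace_conjg A B : \tr (A ^ B)%g = \tr A.
Proof.
by rewrite conjgE /= mxtrace_mulC -mulmxA mulmxV ?mulmx1 // SL2_unitmx.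
Qed.

Lemma mxtrace_invg A : \tr (A^-1)%g = \tr A.
Proof.
rewrite /= /invmx SL2_unitmx det_SL2 invr1 scale1r.
rewrite !mxtrace22 !mxE /cofactor !det_mx11 !mxE /= -signr_odd expr0.
have -> : lift 0 0 = 1 :> 'I_2 by apply: val_inj.
have -> : lift 1 0 = 0 :> 'I_2 by apply: val_inj.
by ring.
Qed.

Lemma mxtrace_SL2_opp A : \tr (SL2_opp A) = - \tr A.
Proof. exact: raddfN. Qed.

Lemma central_scalar A :
  A 0 1 = 0 -> A 1 0 = 0 -> A 0 0 = A 1 1 -> central_SL2 A.
Proof.
move=> h01 h10 h B; apply: val_inj; rewrite /=.
by apply: eq_mx22; rewrite !mulmx22E ?h01 ?h10 ?h; ring.
Qed.

(** This is the discriminant of the characteristic polynomial. If it vanishes, the two eigenvalues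
    agree, and a diagonalizable matrix with a single eigenvalue is scalar. *)
Lemma semisimple_mxtrace A :
  semisimple_SL2 A -> ~ central_SL2 A -> \tr A ^+ 2 - 4%:R != 0.
Proof.
case=> L [P Pu /(diagonalizable_forLR Pu)[D]].
rewrite mxpoly.conjVmx // => eA nc; apply/eqP=> tr0; apply: nc.
set B := map_mx _ _ in eA.
have trB : D 0 0 + D 0 1 = in_alg L (\tr A).
  transitivity (\tr (diag_mx D)); first by rewrite mxtrace22 !mxE /=.
  transitivity (\tr B).
    by rewrite eA mxtrace_mulC mulmxA mulmxV // mul1mx.
  by rewrite !mxtrace22 !mxE rmorphD.
have detB : D 0 0 * D 0 1 = 1.
  transitivity (\det (diag_mx D)).
    by rewrite det_mx22 !mxE /= !mulr0n mulr0 subr0 !mulr1n.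
  transitivity (\det B).
    by rewrite eA !det_mulmx det_inv mulrAC mulVf ?mul1r // -unitfE -unitmxE.
  by rewrite det_map_mx det_SL2 rmorph1.
have D01 : D 0 0 = D 0 1.
  apply/eqP; rewrite -subr_eq0 -sqrf_eq0.
  rewrite (_ : _ ^+ _ = (D 0 0 + D 0 1) ^+ 2 - 4%:R * (D 0 0 * D 0 1)); last ring.
  rewrite trB detB mulr1 -rmorphXn -(rmorph_nat (in_alg L) 4) -rmorphB tr0.
  by rewrite rmorph0.
have DE : diag_mx D = (D 0 0)%:M.
  by apply: eq_mx22; rewrite !mxE /= ?mulr1n ?mulr0n // D01.
have BE : B = (D 0 0)%:M.
  by rewrite eA DE mul_mx_scalar -scalemxAl mulVmx // scalemx1.
have E i j : in_alg L (A i j) = B i j by rewrite mxE.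
apply: central_scalar; apply: (fmorph_inj (in_alg L)).
- by apply: (etrans (E _ _)); rewrite BE rmorph0 mxE mulr0n.
- by apply: (etrans (E _ _)); rewrite BE rmorph0 mxE mulr0n.
- by apply: (etrans (E _ _)); apply: (etrans _ (esym (E _ _))); rewrite BE !mxE !mulr1n.
Qed.

(* The rows are [v = (x, y)] and [v A]. *)
Definition cyclic_mx A (x y : k) : 'M[k]_2 :=
  mx22 x y (x * A 0 0 + y * A 1 0) (x * A 0 1 + y * A 1 1).

Lemma det_cyclic_mx A x y : \det (cyclic_mx A x y) =
  A 0 1 * x ^+ 2 + (A 1 1 - A 0 0) * (x * y) - A 1 0 * y ^+ 2.
Proof. by rewrite det_mx22 !mx22E; ring. Qed.

(** The second rows agree by Cayley-Hamilton: [v A^2 = (\tr A) v A - v]. *)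
Lemma companion_cyclic_mx A x y :
  companion (\tr A) *m cyclic_mx A x y = cyclic_mx A x y *m A.
Proof.
have e z : - 1 * z = - (A 0 0 * A 1 1 - A 0 1 * A 1 0) * z by rewrite det_SL2E.
by apply: eq_mx22; rewrite !mulmx22E !mx22E ?e ?mxtrace22; ring.
Qed.

(** The determinant of [cyclic_mx A x y] is a binary form in [(x, y)] of discriminant
    [\tr A ^+ 2 - 4]; it represents 1, which puts the conjugating matrix in SL2. *)
Lemma companion_conj A : u_invariant_le2 k -> \tr A ^+ 2 - 4%:R != 0 ->
  exists P, (A ^ P)%g = companion (\tr A).
Proof.
move=> hu dn0.
have [|x [y e]] := binary_represents1 (a := A 0 1) (b := A 1 1 - A 0 0)
  (c := - A 1 0) hu.
  apply: contraNneq dn0 => h; apply/eqP; rewrite -[RHS]h mxtrace22.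
  transitivity ((A 0 0 + A 1 1) ^+ 2
    - 4%:R * (A 0 0 * A 1 1 - A 0 1 * A 1 0)); last by ring.
  by rewrite det_SL2E mulr1.
have dM : \det (cyclic_mx A x y) == 1.
  by rewrite det_cyclic_mx -e; apply/eqP; ring.
exists (MkSL2 dM)^-1%g.
apply: (monoid.mulIg (MkSL2 dM)); rewrite conjgE monoid.invgK.
rewrite -!monoid.mulgA monoid.mulVg monoid.mulg1.
by apply: val_inj; rewrite /= -companion_cyclic_mx.
Qed.

Lemma SL2_conj_mxtrace A B : u_invariant_le2 k -> \tr A ^+ 2 - 4%:R != 0 ->
  \tr A = \tr B -> exists P, B = (A ^ P)%g.
Proof.
move=> hu dn0 tAB; have [P eP] := companion_conj hu dn0.
rewrite tAB in dn0; have [Q eQ] := companion_conj hu dn0.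
exists (P * Q^-1)%g; rewrite monoid.conjgM eP tAB -eQ.
by rewrite monoid.conjgK.
Qed.

Lemma companion_factor (t t1 t2 : k) :
  u_invariant_le2 k -> t1 <> t2 -> t1 <> - t2 ->
  exists X Y, [/\ (X * Y)%g = companion t, \tr X = t1 & \tr Y = t2].
Proof.
move=> hu n1 n2; have [p [q e]] := conic_point hu t n1 n2.
pose r := q + t * p - t2.
have dX : \det (mx22 p q r (t1 - p)) == 1 by rewrite det_mx22 !mx22E /r e.
(* This matrix is the adjugate of the previous one times [companion t]. *)
have dY : \det (mx22 q (t1 - p - t * q) (- p) (- r + t * p)) == 1.
  by rewrite det_mx22 !mx22E -e; apply/eqP; rewrite /r; ring.
exists (MkSL2 dX), (MkSL2 dY); split; last 2 first.
- by rewrite mxtrace22 !mx22E; ring.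
- by rewrite mxtrace22 !mx22E /r; ring.
apply: val_inj; apply: eq_mx22; rewrite !mulmx22E !mx22E.
- by ring.
- by rewrite -[RHS]e /r; ring.
- by rewrite -[in RHS]e /r; ring.
- by rewrite -[RHS]mulr1 -[in RHS]e /r; ring.
Qed.

(* A non-scalar matrix of determinant 1 has a cyclic vector, so it is conjugate
   under GL2, in general not SL2, to its companion matrix; this is enough since
   the factors are only prescribed by their traces. *)
Lemma noncentral_factor A (t1 t2 : k) :
  u_invariant_le2 k -> ~ central_SL2 A -> t1 <> t2 -> t1 <> - t2 ->
  exists X Y, [/\ (X * Y)%g = A, \tr X = t1 & \tr Y = t2].
Proof.
move=> hu nc n1 n2.
have [x [y d0]] : exists x y, A 0 1 * x ^+ 2 + (A 1 1 - A 0 0) * (x * y)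
    - A 1 0 * y ^+ 2 != 0.
  (* If the form vanishes at [(1, 0)], [(0, 1)] and [(1, 1)], then [A] is scalar. *)
  apply: contrapT => h; apply: nc.
  have {}h x y : A 0 1 * x ^+ 2 + (A 1 1 - A 0 0) * (x * y) - A 1 0 * y ^+ 2 = 0.
    by apply/eqP; apply: contrapT => /negP hxy; apply: h; exists x, y.
  have h01 : A 0 1 = 0 by rewrite -[RHS](h 1 0); ring.
  have h10 : A 1 0 = 0 by rewrite -[RHS]oppr0 -[in RHS](h 0 1); ring.
  apply: central_scalar => //; apply/esym/eqP; rewrite -subr_eq0 -(h 1 1).
  by rewrite h01 h10; apply/eqP; ring.
pose M := cyclic_mx A x y.
have Mu : M \in unitmx by rewrite unitmxE unitfE det_cyclic_mx.
have [X [Y [XY tX tY]]] := companion_factor (\tr A) hu n1 n2.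
have dJ Z : \det (invmx M *m SL2val Z *m M) == 1.
  rewrite !det_mulmx det_inv det_SL2 mulr1 mulVf //.
  by rewrite -unitfE -unitmxE.
have trJ Z : \tr (invmx M *m SL2val Z *m M) = \tr Z.
  by rewrite mxtrace_mulC mulmxA mulmxV // mul1mx.
exists (MkSL2 (dJ X)), (MkSL2 (dJ Y)); split; rewrite ?trJ //.
apply: val_inj => /=.
rewrite -!mulmxA (mulmxA M) mulmxV // mul1mx (mulmxA X).
have -> : X *m Y = companion (\tr A) by rewrite -XY.
by rewrite companion_cyclic_mx mulmxA mulVmx // mul1mx.
Qed.

(** Commuting with the two elementary unipotents forces a scalar, and determinant 1 leaves only 1
    and -1. *)
Lemma central_toPSL2 A : central_SL2 A -> toPSL2 A = 1%g.
Proof.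
move=> cA.
have dU : \det (mx22 1 1 0 1 : 'M[k]_2) == 1.
  by apply/eqP; rewrite det_mx22 !mx22E; ring.
have dV : \det (mx22 1 0 1 1 : 'M[k]_2) == 1.
  by apply/eqP; rewrite det_mx22 !mx22E; ring.
have /(congr1 val)/= eU := cA (MkSL2 dU); have /(congr1 val)/= eV := cA (MkSL2 dV).
have := congr1 (fun M : 'M[k]_2 => M 0 0) eU; rewrite !mulmx22E !mx22E.
rewrite !(mulr1, mulr0, mul1r, addr0) => /eqP; rewrite -subr_eq0 opprD addrA subrr.
rewrite add0r oppr_eq0 => /eqP h10.
have := congr1 (fun M : 'M[k]_2 => M 0 0) eV; rewrite !mulmx22E !mx22E.
rewrite !(mulr1, mulr0, mul1r, mul0r, addr0) => /eqP; rewrite addrC -subr_eq0 addrK.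
move=> /eqP h01.
have := congr1 (fun M : 'M[k]_2 => M 0 1) eU; rewrite !mulmx22E !mx22E.
rewrite !(mulr1, mulr0, mul1r, addr0) h01 addr0 add0r => h.
have := det_SL2E A; rewrite h01 mul0r subr0 -h -expr2 => /eqP.
rewrite sqrf_eq1 => s; apply/eqP; rewrite -toPSL2_1 toPSL2_eq /SL2_sim.
case/orP: s => /eqP s; apply/orP; [left | right]; apply/eqP/val_inj => /=;
  by apply: eq_mx22; rewrite ?h01 ?h10 -?h ?s !mxE /= ?mulr1n ?mulr0n ?oppr0.
Qed.

Lemma conj_toPSL2 A B : (toPSL2 A ^ toPSL2 B)%g = toPSL2 (A ^ B)%g.
Proof.
rewrite !conjgE !toPSL2M; congr (_ * _)%g.
by apply: (monoid.mulIg (toPSL2 B)); rewrite monoid.mulVg -toPSL2M monoid.mulVg.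
Qed.

Lemma conj_class_toPSL2P A (z : PSL2 k) :
  conj_class (toPSL2 A) z <-> exists B, z = toPSL2 (A ^ B)%g.
Proof.
split=> [[x _ <-]|[B ->]]; first by exists (repr x); rewrite -conj_toPSL2 PSL2_reprK.
by exists (toPSL2 B); rewrite ?conj_toPSL2.
Qed.

Lemma eq_conj_class (G : groupType) (g h : G) :
  conj_class h g -> conj_class g = conj_class h.
Proof.
case=> x _ <-; apply/seteqP; split=> z [y _ <-].
  by exists (x * y)%g => //; rewrite monoid.conjgM.
by exists (x^-1 * y)%g => //; rewrite monoid.conjgM monoid.conjgK.
Qed.

Lemma eq_conj_class_toPSL2 A B : u_invariant_le2 k ->
  \tr A ^+ 2 - 4%:R != 0 -> \tr A = \tr B \/ \tr A = - \tr B ->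
  conj_class (toPSL2 B) = conj_class (toPSL2 A).
Proof.
move=> hu dn0 tAB; apply: eq_conj_class; apply/conj_class_toPSL2P.
case: tAB => [/(SL2_conj_mxtrace hu dn0)[P ->]|]; first by exists P.
rewrite -mxtrace_SL2_opp => /(SL2_conj_mxtrace hu dn0)[P eP].
by exists P; rewrite -eP toPSL2_opp.
Qed.

End SL2Theory.

Theorem theorem1p2 (k : fieldType)
  (hu : u_invariant_le2 k)
  (hq : ~ quadratically_closed k)
  (hchar : 2%N \notin [pchar k]%R)
  (hcard : card_ge k 5)
  (C1 C2 : set (PSL2 k))
  (hC1 : semisimple_class C1)
  (hC2 : semisimple_class C2)
  (hC12 : C1 <> C2) :
  set_prod C1 C2 = ([set: PSL2 k] `\ (1%g : PSL2 k))%classic.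
Proof.
move: hC12; case: hC1 => _ [[A1 [ss1 nc1 <-]] ->].
case: hC2 => _ [[A2 [ss2 nc2 <-]] ->] hC12.
have d1 := semisimple_mxtrace ss1 nc1; have d2 := semisimple_mxtrace ss2 nc2.
have n1 : \tr A1 <> \tr A2.
  by move=> h; apply: hC12; rewrite (@eq_conj_class_toPSL2 _ A1 A2) //; left.
have n2 : \tr A1 <> - \tr A2.
  by move=> h; apply: hC12; rewrite (@eq_conj_class_toPSL2 _ A1 A2) //; right.
apply/seteqP; split=> [z|z [_ /= z1]].
  case=> x /conj_class_toPSL2P[P ->] [y /conj_class_toPSL2P[Q ->] <-].
  (* A trivial product makes one factor the inverse of the other up to sign; as inversion preserves
     traces in SL2, the traces would agree up to sign. *)
  split=> //= /eqP; rewrite -toPSL2M -toPSL2_1 toPSL2_eq => /orP[] /eqP h.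
    apply: n1; rewrite -(mxtrace_conjg A1 P) -(mxtrace_conjg A2 Q).
    by rewrite -(mxtrace_invg (A1 ^ P)%g) (monoid.mulg1_eq h).
  apply: n2; rewrite -(mxtrace_conjg A1 P) -(mxtrace_conjg A2 Q).
  have {}h : ((A1 ^ P) * SL2_opp (A2 ^ Q) = 1)%g.
    by rewrite SL2_mulE SL2_mulNr -SL2_mulE h SL2_oppK.
  by rewrite -mxtrace_SL2_opp -(mxtrace_invg (A1 ^ P)%g) (monoid.mulg1_eq h).
have nc : ~ central_SL2 (repr z).
  by move=> /central_toPSL2; rewrite PSL2_reprK.
(* The prescribed traces alone place [X] and [Y] in the SL2-classes of [A1] and [A2]. *)
have [X [Y [XY tX tY]]] := noncentral_factor hu nc n1 n2.
have [P eX] := SL2_conj_mxtrace hu d1 (esym tX).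
have [Q eY] := SL2_conj_mxtrace hu d2 (esym tY).
exists (toPSL2 X); first by apply/conj_class_toPSL2P; exists P; rewrite eX.
exists (toPSL2 Y); first by apply/conj_class_toPSL2P; exists Q; rewrite eY.
by rewrite -toPSL2M XY PSL2_reprK.
Qed.
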